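(* Let $\rho\in\mathbf{Pr}_2(\Omega)$ satisfy $\int_\Omega\|\mathbf{A}(\theta,:)\|^2\,d\rho(\theta)<\infty$ and be such that the matrix $\mathbf{A}^\top\mathbf{A}[\rho]=\int_\Omega\mathbf{A}(\theta,:)^\top\mathbf{A}(\theta,:)\,d\rho(\theta)\in\mathbb{R}^{d\times d}$ is invertible. Let $$F^A[\rho]=\mathrm{Tr}\big((\mathbf{A}^\top\mathbf{A}[\rho])^{-1}\big),\qquad F^D[\rho]=\log\det\big(\mathbf{A}^\top\mathbf{A}[\rho]\big).$$ Then $F^A$ and $F^D$ are second-order directionally differentiable at $\rho$, i.e. $\mathrm{Hess}\,F^A[\rho](\eta_1,\eta_2)$ and $\mathrm{Hess}\,F^D[\rho](\eta_1,\eta_2)$ exist for all admissible directions $\eta_1,\eta_2$, and the Hessian of $F^A$ is positive semidefinite while the Hessian of $F^D$ is negative semidefinite: $$\mathrm{Hess}\,F^A[\rho](\eta,\eta)\ge 0,\qquad \mathrm{Hess}\,F^D[\rho](\eta,\eta)\le 0\qquad\text{for every admissible direction }\eta.$$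
   Context: $\Omega\subseteq\mathbb{R}^p$ is a Borel set (the design space), and $\mathbf{Pr}_2(\Omega)$ is the set of Borel probability measures on $\Omega$ with finite second moment. The ''continuous data matrix'' $\mathbf{A}$ is a Borel measurable map $\theta\mapsto\mathbf{A}(\theta,:)$ from $\Omega$ to real row vectors of length $d$. For any signed measure $\mu$ on $\Omega$ with $\int_\Omega\|\mathbf{A}(\theta,:)\|^2\,d|\mu|(\theta)<\infty$, put $\mathbf{A}^\top\mathbf{A}[\mu]=\int_\Omega\mathbf{A}(\theta,:)^\top\mathbf{A}(\theta,:)\,d\mu(\theta)$. The functionals $F^A,F^D$ are extended by the same formulas to signed measures $\mu$ for which $\mathbf{A}^\top\mathbf{A}[\mu]$ is positive definite. An admissible direction is a finite signed Borel measure $\eta$ on $\Omega$ with $\eta(\Omega)=0$, $\int_\Omega|\theta|^2\,d|\eta|(\theta)<\infty$ and $\int_\Omega\|\mathbf{A}(\theta,:)\|^2\,d|\eta|(\theta)<\infty$. The Hessian of a functional $F$ at $\rho$ is, for admissible directions $\eta_1,\eta_2$, $$\mathrm{Hess}\,F[\rho](\eta_1,\eta_2)=\lim_{\varepsilon\to0}\frac{\big(F[\rho+\varepsilon\eta_1+\varepsilon\eta_2]-F[\rho+\varepsilon\eta_2]\big)-\big(F[\rho+\varepsilon\eta_1]-F[\rho]\big)}{\varepsilon^2}.$$ *)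

(* Defs.v *)
From HB Require Import structures.
From mathcomp Require Import all_boot all_order all_algebra.
From mathcomp Require Import all_classical all_reals all_analysis.

Set Implicit Arguments.
Unset Strict Implicit.
Unset Printing Implicit Defensive.

Import Order.TTheory GRing.Theory Num.Theory.
Import numFieldNormedType.Exports.

Local Open Scope classical_set_scope.
Local Open Scope ring_scope.

(* A finite signed measure is a charge. Its Jordan parts, its total variation
   and the integral against it do not depend on the chosen Hahn
   decomposition (Hahn_decomposition_uniq). *)
Section signed_measures.
Context {disp : measure_display} {T : measurableType disp} {R : realType}.
Implicit Type mu : {charge set T -> \bar R}.

Lemma hahn_pair_exists mu :
  exists PN : set T * set T, hahn_decomposition mu PN.1 PN.2.
Proof. by have [P [N PN]] := Hahn_decomposition mu; exists (P, N). Qed.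

Definition hahn_pair mu :
    {PN : set T * set T | hahn_decomposition mu PN.1 PN.2} :=
  cid (hahn_pair_exists mu).

Definition pos_part mu : {measure set T -> \bar R} :=
  jordan_pos (svalP (hahn_pair mu)).

Definition neg_part mu : {measure set T -> \bar R} :=
  jordan_neg (svalP (hahn_pair mu)).

Definition total_variation mu : {measure set T -> \bar R} :=
  charge_variation (svalP (hahn_pair mu)).

Definition charge_Rintegral mu (D : set T) (f : T -> R) : R :=
  Rintegral (pos_part mu) D f - Rintegral (neg_part mu) D f.

(* Signed measures on a measurable subset D of T are identified with those
   on T that vanish on every measurable set disjoint from D. *)
Definition concentrated_on (D : set T) (mu : set T -> \bar R) : Prop :=
  forall B, measurable B -> B `<=` ~` D -> mu B = 0%E.

(* Second-order directional derivatives of a functional F defined on the set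
   dom of signed measures; the values of F outside dom are irrelevant. *)
Definition hessian_quotient (F : {charge set T -> \bar R} -> R)
    (rho eta1 eta2 : {charge set T -> \bar R}) (e : R) : R :=
  ((F (cadd (cadd rho (cscale e eta1)) (cscale e eta2))
      - F (cadd rho (cscale e eta2)))
   - (F (cadd rho (cscale e eta1)) - F rho)) / e ^+ 2.

Definition hessian_exists (dom : {charge set T -> \bar R} -> Prop)
    (F : {charge set T -> \bar R} -> R)
    (rho eta1 eta2 : {charge set T -> \bar R}) : Prop :=
  [/\ dom rho,
      \forall e \near (0 : R)^',
        [/\ dom (cadd (cadd rho (cscale e eta1)) (cscale e eta2)),
            dom (cadd rho (cscale e eta1)) &
            dom (cadd rho (cscale e eta2))] &
      cvg (hessian_quotient F rho eta1 eta2 e @[e --> (0 : R)^'])].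

Definition hessian (F : {charge set T -> \bar R} -> R)
    (rho eta1 eta2 : {charge set T -> \bar R}) : R :=
  lim (hessian_quotient F rho eta1 eta2 e @[e --> (0 : R)^']).

End signed_measures.

Notation borel_rV R n := (g_sigma_algebraType (@open 'rV[R]_n)).

(* The norm `|v| of the library on 'rV[R]_n is the maximum norm. *)
Definition sqnorm2 {R : realType} {n : nat} (v : 'rV[R]_n) : R :=
  \sum_(i < n) (v 0 i) ^+ 2.

Definition posdefmx {R : realType} {n : nat} (M : 'M[R]_n) : Prop :=
  M^T = M /\ forall v : 'rV[R]_n, v != 0 -> 0 < (v *m M *m v^T) 0 0.

Section design.
Context {R : realType} {p d : nat}.
Variables (Omega : set (borel_rV R p)) (A : borel_rV R p -> borel_rV R d).
Implicit Type mu : {charge set (borel_rV R p) -> \bar R}.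

Definition gram mu : 'M[R]_d :=
  \matrix_(i < d, j < d)
    charge_Rintegral mu Omega (fun theta => ((A theta)^T *m A theta) i j).

Definition design_dom mu : Prop :=
  [/\ concentrated_on Omega mu,
      (\int[total_variation mu]_(theta in Omega) (sqnorm2 (A theta))%:E
         < +oo)%E &
      posdefmx (gram mu)].

(* Off the domain design_dom these are total-function artefacts: invmx and ln
   have conventional values there. *)
Definition FA mu : R := \tr (invmx (gram mu)).

Definition FD mu : R := ln (\det (gram mu)).

Definition admissible (eta : {charge set (borel_rV R p) -> \bar R}) : Prop :=
  [/\ concentrated_on Omega eta,
      eta Omega = 0%E,
      (\int[total_variation eta]_(theta in Omega) (sqnorm2 theta)%:E < +oo)%E &
      (\int[total_variation eta]_(theta in Omega) (sqnorm2 (A theta))%:E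
         < +oo)%E].

End design.

(* Main.v *)
(* The Gram matrix is linear in the signed measure, so both functionals are
   studied along the matrix pencil G + e K, with G the Gram matrix of rho, which
   is positive definite, and X = G^-1.
   For F^A, the resolvent identity gives
     tr (G + e K)^-1 = tr X - e tr (X K X) + e^2 tr (X K X K (G + e K)^-1);
   the linear terms cancel in the second difference, and the Hessian on (H, H)
   is 2 tr (Y G Y) with Y = X H X.
   For F^D, det (1 + e M) = 1 + e tr M + e^2 ((tr M)^2 - tr M^2) / 2 + O(e^3)
   with M = X K, and the Hessian on (H, H) is - tr (X H X H).
   Both traces have the form tr (G P) with P positive semidefinite, hence equal
   the integral of the nonnegative function A P A^T. *)
Require Import Defs.
From mathcomp Require Import all_boot all_order all_algebra.
From mathcomp Require Import all_classical all_reals all_analysis.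
From mathcomp Require Import measurable_realfun.
From mathcomp Require Import ring lra.

Set Implicit Arguments.
Unset Strict Implicit.
Unset Printing Implicit Defensive.

Import Order.TTheory GRing.Theory Num.Theory.
Import numFieldNormedType.Exports.

Local Open Scope classical_set_scope.
Local Open Scope ring_scope.

(** * Integration against the Jordan parts of a charge *)

Section signed_integral.
Local Open Scope ereal_scope.
Context {disp : measure_display} {T : measurableType disp} {R : realType}.
Variables (D : set T) (mD : measurable D).
Implicit Types (mu nu : {charge set T -> \bar R}) (f : T -> R).
Implicit Types m : {measure set T -> \bar R}.

Lemma ge0_le_measure_integral_on m1 m2 (g : T -> \bar R) :
  (forall B, measurable B -> m1 B <= m2 B) -> (forall x, D x -> 0 <= g x) ->
  measurable_fun D g ->
  \int[m1]_(x in D) g x <= \int[m2]_(x in D) g x.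
Proof.
move=> m12 g0 mg; rewrite [leLHS]integral_mkcond [leRHS]integral_mkcond.
apply: ge0_le_measure_integral => //.
- by move=> x; rewrite patchE; case: ifPn => // /[!inE] /g0.
- by move/(measurable_restrictT _ mD): mg.
Qed.

Lemma le_measure_integrable m1 m2 (g : T -> \bar R) :
  (forall B, measurable B -> m1 B <= m2 B) ->
  m2.-integrable D g -> m1.-integrable D g.
Proof.
move=> m12 /integrableP[mg g2]; apply/integrableP; split=> //.
apply: le_lt_trans g2; apply: ge0_le_measure_integral_on => //.
exact: measurableT_comp.
Qed.

Lemma pos_part_neg_partE mu B : measurable B ->
  mu B = pos_part mu B - neg_part mu B.
Proof.
move=> mB; rewrite (jordan_decomp (svalP (hahn_pair mu)) mB) /cadd /=.
by rewrite cscaleN1.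
Qed.

Lemma pos_part_fin_num mu B : measurable B -> pos_part mu B \is a fin_num.
Proof. by move=> mB; apply: fin_num_measure. Qed.

Lemma neg_part_fin_num mu B : measurable B -> neg_part mu B \is a fin_num.
Proof. by move=> mB; apply: fin_num_measure. Qed.

(** Integrability against both Jordan parts is the working form of integrability against the total
    variation; [cintegrableP] links the two. *)
Definition cintegrable mu f :=
  (pos_part mu).-integrable D (EFin \o f) /\
  (neg_part mu).-integrable D (EFin \o f).

Lemma total_variation_measure_add mu B :
  Defs.total_variation mu B = measure_add (pos_part mu) (neg_part mu) B.
Proof. by rewrite measure_addE. Qed.

Lemma cintegrableP mu f :
  cintegrable mu f <-> (Defs.total_variation mu).-integrable D (EFin \o f).
Proof.
have itv : measurable_fun D (EFin \o f) ->
  \int[Defs.total_variation mu]_(x in D) `|(EFin \o f) x| =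
  \int[pos_part mu]_(x in D) `|(EFin \o f) x| +
  \int[neg_part mu]_(x in D) `|(EFin \o f) x|.
  move=> mf; rewrite -ge0_integral_measure_add//.
    by apply: eq_measure_integral => B mB _; rewrite total_variation_measure_add.
  exact: measurableT_comp.
split=> [[/integrableP[mf p] /integrableP[_ n]]|/integrableP[mf]].
  by apply/integrableP; split=> //; rewrite itv// lte_add_pinfty.
move=> tv; split; apply/integrableP; split=> //; apply: le_lt_trans tv;
  by rewrite itv// ?leeDl ?leeDr// integral_ge0.
Qed.

(* The Jordan decomposition is the smallest one, and any other one m1 - m2
   satisfies pos_part mu + m2 = neg_part mu + m1. *)
Lemma charge_Rintegral_diff mu m1 m2 f :
  (forall B, measurable B -> mu B + m2 B = m1 B) ->
  (forall B, measurable B -> m2 B \is a fin_num) ->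
  m1.-integrable D (EFin \o f) -> m2.-integrable D (EFin \o f) ->
  cintegrable mu f /\
  charge_Rintegral mu D f = (Rintegral m1 D f - Rintegral m2 D f)%R.
Proof.
move=> mu12 fin2 i1 i2.
have [[mP _] [mN _] _ _] := svalP (hahn_pair mu).
have posE B : measurable B -> pos_part mu B = mu (B `&` (sval (hahn_pair mu)).1).
  by move=> mB; rewrite -[LHS]/(crestr0 mu mP B) /crestr0 mem_set.
have negE B : measurable B -> neg_part mu B = - mu (B `&` (sval (hahn_pair mu)).2).
  move=> mB; rewrite -[LHS]/((-1)%:E * crestr0 mu mN B) /crestr0 mem_set//.
  by rewrite EFinN mulN1e.
have fin1 B : measurable B -> m1 B \is a fin_num.
  by move=> mB; rewrite -mu12// fin_numD fin2// fin_num_measure.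
have muE B : measurable B -> mu B = m1 B - m2 B.
  by move=> mB; rewrite -mu12// addeK// fin2.
(* With [P] the positive set of the Hahn decomposition, the left side is [m1 (B & P) - m2 (B & P)],
   hence at most [m1 (B & P)]. The bound on [neg_part] is the same on the negative set. *)
have pos1 B : measurable B -> pos_part mu B <= m1 B.
  move=> mB; rewrite posE//; have mBP := measurableI _ _ mB mP.
  rewrite muE// (@le_trans _ _ (m1 (B `&` (sval (hahn_pair mu)).1)))//.
    by rewrite leeBlDr ?fin2// leeDl.
  by rewrite le_measure ?inE.
have neg2 B : measurable B -> neg_part mu B <= m2 B.
  move=> mB; rewrite negE//; have mBN := measurableI _ _ mB mN.
  rewrite muE// oppeB ?fin_num_adde_defl ?fin2// ?fin_numN ?fin2//.
  rewrite (@le_trans _ _ (m2 (B `&` (sval (hahn_pair mu)).2)))//.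
    by rewrite addeC leeBlDr ?fin1// leeDl.
  by rewrite le_measure ?inE.
have ip := le_measure_integrable pos1 i1.
have i_n := le_measure_integrable neg2 i2.
split=> //; have mf := measurable_int _ i1.
have : \int[measure_add (pos_part mu) m2]_(x in D) (EFin \o f) x =
       \int[measure_add (neg_part mu) m1]_(x in D) (EFin \o f) x.
  apply: eq_measure_integral => B mB _.
  rewrite -[LHS]/(measure_add _ _ B) -[RHS]/(measure_add _ _ B) !measure_addE.
  rewrite -mu12// addeA; congr (_ + _); rewrite addeC (pos_part_neg_partE mu)//.
  by rewrite subeK// neg_part_fin_num.
rewrite !integral_measure_add// => /(congr1 fine).
rewrite (fineD (integrable_fin_num mD ip) (integrable_fin_num mD i2)).
rewrite (fineD (integrable_fin_num mD i_n) (integrable_fin_num mD i1)) => e.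
rewrite /charge_Rintegral; apply/eqP; rewrite subr_eq addrAC eq_sym subr_eq.
by rewrite addrC -e.
Qed.

End signed_integral.

(** * Linearity of the integral in the signed measure *)

Section signed_integral_linear.
Local Open Scope ereal_scope.
Context {disp : measure_display} {T : measurableType disp} {R : realType}.
Variables (D : set T) (mD : measurable D).
Implicit Types (mu nu : {charge set T -> \bar R}) (f g : T -> R).

Lemma integrable_measure_add (m1 m2 : {measure set T -> \bar R})
    (g : T -> \bar R) :
  m1.-integrable D g -> m2.-integrable D g ->
  (measure_add m1 m2).-integrable D g.
Proof.
move=> /integrableP[mg g1] /integrableP[_ g2]; apply/integrableP; split=> //.
rewrite ge0_integral_measure_add//; last exact: measurableT_comp.
exact: lte_add_pinfty.
Qed.

Lemma integrable_mscale (m : {measure set T -> \bar R}) (k : {nonneg R})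
    (g : T -> \bar R) :
  m.-integrable D g -> (mscale k m).-integrable D g.
Proof.
move=> /integrableP[mg gm]; apply/integrableP; split=> //.
rewrite ge0_integral_mscale//; last exact: measurableT_comp.
by rewrite lte_mul_pinfty.
Qed.

Lemma Rintegral_mscale (m : {measure set T -> \bar R}) (k : {nonneg R}) f :
  m.-integrable D (EFin \o f) ->
  Rintegral (mscale k m) D f = (k%:num * Rintegral m D f)%R.
Proof.
move=> im; have mf := measurable_int _ im.
(* Since [f] may change sign, the scaling rule is applied to its positive and negative parts
   separately. *)
rewrite /Rintegral integralE ge0_integral_mscale//; last exact: measurable_funepos.
rewrite ge0_integral_mscale//; last exact: measurable_funeneg.
rewrite -muleBr ?fin_num_adde_defl// ?fin_numN ?integrable_neg_fin_num//.
by rewrite -integralE fineM// integrable_fin_num.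
Qed.

Lemma Rintegral_measure_add (m1 m2 : {measure set T -> \bar R}) f :
  m1.-integrable D (EFin \o f) -> m2.-integrable D (EFin \o f) ->
  Rintegral (measure_add m1 m2) D f = (Rintegral m1 D f + Rintegral m2 D f)%R.
Proof.
move=> i1 i2; have mf := measurable_int _ i1.
by rewrite /Rintegral integral_measure_add// fineD// integrable_fin_num.
Qed.

(** Jordan parts are not additive, because masses of opposite sign may cancel. The sums of the parts
    still form a decomposition of the sum, which is all that [charge_Rintegral_diff] requires. *)
Lemma charge_Rintegral_cadd mu nu f :
  cintegrable D mu f -> cintegrable D nu f ->
  cintegrable D (cadd mu nu) f /\
  charge_Rintegral (cadd mu nu) D f =
  (charge_Rintegral mu D f + charge_Rintegral nu D f)%R.
Proof.
move=> [pm nm] [pn nn].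
have [] := @charge_Rintegral_diff _ _ _ D mD (cadd mu nu)
  (measure_add (pos_part mu) (pos_part nu))
  (measure_add (neg_part mu) (neg_part nu)) f.
- move=> B mB; rewrite -[LHS]/((mu B + nu B) + measure_add _ _ B).
  rewrite -[RHS]/(measure_add _ _ B) !measure_addE.
  rewrite (pos_part_neg_partE mu)// (pos_part_neg_partE nu)//.
  by rewrite addeACA !subeK// neg_part_fin_num.
- move=> B mB; rewrite -[X in X \is a _]/(measure_add _ _ B) measure_addE.
  by rewrite fin_numD !neg_part_fin_num.
- exact: integrable_measure_add.
- exact: integrable_measure_add.
move=> ci ->; split=> //; rewrite !Rintegral_measure_add//.
by rewrite /charge_Rintegral opprD addrACA.
Qed.

Lemma charge_Rintegral_cscale (k : R) mu f :
  cintegrable D mu f ->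
  cintegrable D (cscale k mu) f /\
  charge_Rintegral (cscale k mu) D f = (k * charge_Rintegral mu D f)%R.
Proof.
move=> [pm nm].
have [k0|k0] := leP 0%R k.
  pose c := NngNum k0.
  have [] := @charge_Rintegral_diff _ _ _ D mD (cscale k mu)
    (mscale c (pos_part mu)) (mscale c (neg_part mu)) f.
  - move=> B mB; rewrite -[LHS]/(k%:E * mu B + k%:E * neg_part mu B).
    rewrite -[RHS]/(k%:E * pos_part mu B) -muleDr ?fin_num_adde_defl//.
      by rewrite (pos_part_neg_partE mu)// subeK// neg_part_fin_num.
    by rewrite neg_part_fin_num.
  - by move=> B mB; rewrite fin_numM// neg_part_fin_num.
  - exact: integrable_mscale.
  - exact: integrable_mscale.
  by move=> ci ->; split=> //; rewrite !Rintegral_mscale// -mulrBr.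
(* A negative factor exchanges the roles of the two Jordan parts, each scaled by [- k]. *)
have k1 : (0 <= - k)%R by rewrite oppr_ge0 ltW.
pose c := NngNum k1.
have [] := @charge_Rintegral_diff _ _ _ D mD (cscale k mu)
  (mscale c (neg_part mu)) (mscale c (pos_part mu)) f.
- move=> B mB; rewrite -[LHS]/(k%:E * mu B + (- k)%:E * pos_part mu B).
  rewrite -[RHS]/((- k)%:E * neg_part mu B) (pos_part_neg_partE mu)//.
  have := neg_part_fin_num mu mB; have := pos_part_fin_num mu mB.
  move=> /fineK <- /fineK <-; rewrite -EFinB -!EFinM -EFinD; congr EFin.
  by rewrite mulrBr mulNr addrAC subrr add0r mulNr.
- by move=> B mB; rewrite fin_numM// pos_part_fin_num.
- exact: integrable_mscale.
- exact: integrable_mscale.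
move=> ci ->; split=> //; rewrite !Rintegral_mscale//= -mulrBr mulNr -mulrN.
by rewrite opprB.
Qed.

Lemma charge_Rintegral_measure (m : {finite_measure set T -> \bar R}) f :
  m.-integrable D (EFin \o f) ->
  cintegrable D (charge_of_finite_measure m) f /\
  charge_Rintegral (charge_of_finite_measure m) D f = Rintegral m D f.
Proof.
move=> im; have mf := measurable_int _ im.
have [] := @charge_Rintegral_diff _ _ _ D mD (charge_of_finite_measure m)
  m mzero f.
- by move=> B mB; rewrite adde0.
- by [].
- exact: im.
- by apply/integrableP; split=> //; rewrite integral_measure_zero.
by move=> ci ->; rewrite /Rintegral integral_measure_zero subr0.
Qed.

End signed_integral_linear.

(** * Quadratic forms and positive definite matrices *)

Section quadratic_form.
Context {R : realType} {n : nat}.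
Implicit Types (M P : 'M[R]_n) (u v w : 'rV[R]_n).

Definition bform M u v : R := (u *m M *m v^T) 0 0.

Definition semiposmx M := M^T = M /\ forall v, 0 <= bform M v v.

Lemma bformDl M u v w : bform M (u + v) w = bform M u w + bform M v w.
Proof. by rewrite /bform !mulmxDl mxE. Qed.

Lemma bformDr M u v w : bform M u (v + w) = bform M u v + bform M u w.
Proof. by rewrite /bform linearD mulmxDr mxE. Qed.

Lemma bformZl M a u v : bform M (a *: u) v = a * bform M u v.
Proof. by rewrite /bform -!scalemxAl mxE. Qed.

Lemma bformZr M a u v : bform M u (a *: v) = a * bform M u v.
Proof. by rewrite /bform linearZ -scalemxAr mxE. Qed.

Lemma bformC M u v : M^T = M -> bform M u v = bform M v u.
Proof.
move=> Ms; have -> : bform M u v = ((u *m M *m v^T)^T) 0 0 by rewrite mxE.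
by rewrite !trmx_mul trmxK Ms mulmxA.
Qed.

Lemma bformDm M P u v : bform (M + P) u v = bform M u v + bform P u v.
Proof. by rewrite /bform mulmxDr mulmxDl mxE. Qed.

Lemma bformZm M a u v : bform (a *: M) u v = a * bform M u v.
Proof. by rewrite /bform -scalemxAr -scalemxAl mxE. Qed.

Lemma bformE M u v : bform M u v = \sum_i \sum_j u 0 i * M i j * v 0 j.
Proof.
rewrite /bform mxE exchange_big; apply: eq_bigr => j _.
by rewrite !mxE mulr_suml.
Qed.

Lemma sqnorm2E v : sqnorm2 v = bform 1%:M v v.
Proof.
by rewrite /bform mulmx1 mxE; apply: eq_bigr => i _; rewrite mxE expr2.
Qed.

Lemma sqnorm2_ge0 v : 0 <= sqnorm2 v.
Proof. by apply: sumr_ge0 => i _; exact: sqr_ge0. Qed.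

Lemma sqnorm2_gt0 v : v != 0 -> 0 < sqnorm2 v.
Proof.
move=> v0; rewrite lt_neqAle sqnorm2_ge0 andbT eq_sym; apply: contra v0 => /eqP e.
apply/eqP/rowP => i; rewrite mxE; apply/eqP; rewrite -sqrf_eq0; apply/eqP.
exact: (psumr_eq0P (fun j _ => sqr_ge0 (v 0 j)) e).
Qed.

Lemma sqr_coord_le v i : v 0 i ^+ 2 <= sqnorm2 v.
Proof. by rewrite /sqnorm2 (bigD1 i)//= lerDl sumr_ge0// => j _; exact: sqr_ge0. Qed.

(** Expanding the squares of [v_i + v_j] and [v_i - v_j] bounds each product [v_i v_j] by [|v|^2] in
    absolute value. *)
Lemma normr_bform_le M v :
  `|bform M v v| <= (\sum_i \sum_j `|M i j|) * sqnorm2 v.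
Proof.
rewrite bformE mulr_suml; apply: le_trans (ler_norm_sum _ _ _) _.
apply: ler_sum => i _; rewrite mulr_suml; apply: le_trans (ler_norm_sum _ _ _) _.
apply: ler_sum => j _; rewrite mulrAC mulrC normrM ler_wpM2l//.
rewrite ler_norml; have := sqr_coord_le v i; have := sqr_coord_le v j.
have := sqr_ge0 (v 0 i + v 0 j); have := sqr_ge0 (v 0 i - v 0 j).
by move=> h1 h2 h3 h4; apply/andP; split; nra.
Qed.

Lemma semiposmx_cauchy_schwarz M u v : semiposmx M ->
  bform M u v ^+ 2 <= bform M u u * bform M v v.
Proof.
move=> [Ms Mp]; set a := bform M u u; set b := bform M u v; set c := bform M v v.
have q s t : 0 <= s ^+ 2 * a + 2 * s * t * b + t ^+ 2 * c.
  have := Mp (s *: u + t *: v).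
  rewrite !(bformDl, bformDr, bformZl, bformZr) -/a -/c (bformC v u Ms) -/b.
  by congr (0 <= _); ring.
have a0 : 0 <= a by exact: Mp.
have c0 : 0 <= c by exact: Mp.
(* The form may be degenerate. If [c] is nonzero, [q c (- b)] reads [0 <= c (a c - b^2)]; the case
   of nonzero [a] is symmetric. If both vanish, [q 1 (- b)] reads [0 <= - 2 b^2]. *)
have [c0'|c0'] := eqVneq c 0; last first.
  have cgt : 0 < c by rewrite lt_neqAle eq_sym c0'.
  rewrite -subr_ge0 -(pmulr_rge0 _ cgt).
  by have := q c (- b); congr (0 <= _); ring.
have [a0'|a0'] := eqVneq a 0; last first.
  have agt : 0 < a by rewrite lt_neqAle eq_sym a0'.
  rewrite -subr_ge0 -(pmulr_rge0 _ agt).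
  by have := q (- b) a; congr (0 <= _); ring.
by have := q 1 (- b); rewrite a0' c0'; nra.
Qed.

Lemma posdefmx_semipos M : posdefmx M -> semiposmx M.
Proof.
move=> [Ms Mp]; split=> // v; have [->|v0] := eqVneq v 0.
  by rewrite /bform !mul0mx mxE.
by rewrite ltW// Mp.
Qed.

(** If [v M v^T = 0], Cauchy-Schwarz for [v] and [v M] gives [|v M|^4 <= 0], so [v M = 0] and
    invertibility forces [v = 0]. *)
Lemma semiposmx_unit_posdef M : semiposmx M -> M \in unitmx -> posdefmx M.
Proof.
move=> Mp Mu; have [Ms Mge] := Mp; split=> // v v0.
rewrite lt_neqAle Mge andbT eq_sym; apply: contra v0 => /eqP v0.
have vM : v *m M = 0.
  apply/eqP; apply/negPn/negP => /sqnorm2_gt0.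
  have := semiposmx_cauchy_schwarz v (v *m M) Mp.
  rewrite /bform v0 mul0r -/(bform 1%:M _ _) => h.
  move: h; rewrite sqnorm2E /bform mulmx1 => h.
  have : ((v *m M *m (v *m M)^T) 0 0) ^+ 2 == 0 by rewrite eq_le h sqr_ge0.
  by rewrite sqrf_eq0 => /eqP ->; rewrite ltxx.
by rewrite -(mulmxK Mu v) vM mul0mx.
Qed.

Lemma posdefmx_unit M : posdefmx M -> M \in unitmx.
Proof.
move=> [_ Mp]; rewrite -row_free_unit; apply/inj_row_free => v vM.
apply/eqP/negPn/negP => /Mp.
by rewrite vM mul0mx mxE ltxx.
Qed.

(* With u = v M^-1, Cauchy-Schwarz for M bounds |v|^2 = bform M v u. *)
Lemma posdefmx_coercive M : posdefmx M ->
  exists2 c, 0 < c & forall v, c * sqnorm2 v <= bform M v v.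
Proof.
move=> Mpd; have Mu := posdefmx_unit Mpd; have Mp := posdefmx_semipos Mpd.
have [Ms Mge] := Mp.
(* The summand 1 keeps [C] positive even in dimension 0, where the sum is empty. *)
pose C := 1 + \sum_i \sum_j `|(invmx M) i j|.
have C0 : 0 < C.
  by rewrite ltr_wpDr// sumr_ge0// => i _; rewrite sumr_ge0.
exists C^-1; first by rewrite invr_gt0.
move=> v; rewrite mulrC ler_pdivrMr//.
have [->|v0] := eqVneq v 0.
  by rewrite sqnorm2E /bform !mul0mx mxE mul0r.
have n0 := sqnorm2_gt0 v0.
have := semiposmx_cauchy_schwarz v (v *m invmx M) Mp.
have iMs : (invmx M)^T = invmx M by rewrite trmx_inv Ms.
have -> : bform M v (v *m invmx M) = sqnorm2 v.
  by rewrite sqnorm2E /bform trmx_mul iMs mulmxA mulmxK// mulmx1.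
have -> : bform M (v *m invmx M) (v *m invmx M) = bform (invmx M) v v.
  by rewrite /bform mulmxKV// trmx_mul iMs mulmxA.
move=> h; rewrite -(ler_pM2r n0) -expr2 (le_trans h)// -mulrA ler_wpM2l//.
apply: le_trans (ler_norm _) _; apply: le_trans (normr_bform_le _ _) _.
by rewrite ler_wpM2r ?sqnorm2_ge0// /C lerDr.
Qed.

(** Coercivity gives a margin [c |v|^2], and the perturbation is at most [|e| C |v|^2], so
    [|e| < c / C] suffices uniformly in [v]. *)
Lemma posdefmx_near M P : posdefmx M -> P^T = P ->
  \forall e \near (0 : R), posdefmx (M + e *: P).
Proof.
move=> Mpd Ps; have [c c0 Mc] := posdefmx_coercive Mpd; have [Ms _] := Mpd.
pose C := 1 + \sum_i \sum_j `|P i j|.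
have C0 : 0 < C.
  by rewrite ltr_wpDr// sumr_ge0// => i _; rewrite sumr_ge0.
near=> e; split; first by rewrite linearD linearZ/= Ms Ps.
move=> v v0; have n0 := sqnorm2_gt0 v0.
rewrite -/(bform _ v v) bformDm bformZm.
have eC : `|e| < c / C.
  by near: e; exact: (@nbhs0_lt R R^o _ (divr_gt0 c0 C0)).
have h : `|e * bform P v v| < c * sqnorm2 v.
  rewrite normrM (@le_lt_trans _ _ (`|e| * (C * sqnorm2 v)))//.
    rewrite ler_wpM2l//; apply: le_trans (normr_bform_le _ _) _.
    by rewrite ler_wpM2r ?sqnorm2_ge0// /C lerDr.
  by rewrite mulrA ltr_pM2r// -ltr_pdivlMr.
have := Mc v; move: h; rewrite ltr_norml => /andP[h _]; lra.
Unshelve. all: by end_near. Qed.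

End quadratic_form.

(** * Determinants of matrix pencils as polynomials in the parameter *)

Section determinant_expansion.
Context {R : realType} {n : nat}.
Implicit Types M P : 'M[R]_n.

(** The determinant is taken over the polynomial ring, and evaluation at [e] is a ring morphism, so
    it commutes with the determinant. Limits in [e] thus reduce to continuity of polynomials. *)
Lemma det_pencil_poly m (A K : 'M[R]_m) :
  exists p : {poly R}, forall e, \det (A + e *: K) = p.[e].
Proof.
exists (\det (map_mx polyC A + 'X *: map_mx polyC K)) => e.
rewrite -[RHS]/(horner_eval e _) -det_map_mx; congr (\det _).
by apply/matrixP => i j; rewrite !mxE /= /horner_eval !hornerE.
Qed.

(** Every matrix on the segment from [M] to the identity is positive definite, hence invertible. A
    negative determinant at [M] would, by the intermediate value theorem, vanish somewhere on that
    segment. *)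
Lemma posdefmx_det_gt0 M : posdefmx M -> 0 < \det M.
Proof.
move=> Mpd; have [Ms Mp] := Mpd.
have Mu := posdefmx_unit Mpd.
rewrite lt_neqAle eq_sym -unitfE -unitmxE Mu /= leNgt; apply/negP => M0.
have [p pE] := det_pencil_poly M (1%:M - M).
have p0 : p.[0] = \det M by rewrite -pE scale0r addr0.
have p1 : p.[1] = 1 by rewrite -pE scale1r addrC subrK det1.
have [|t /andP[t0 t1] /rootP] := @poly_ivt R p 0 1 ler01.
  by rewrite p0 p1 ler01 ltW.
rewrite -pE => d0.
suff /posdefmx_unit : posdefmx (M + t *: (1%:M - M)).
  by rewrite unitmxE d0 unitr0.
split; first by rewrite linearD linearZ linearB /= Ms trmx1.
move=> v v0; rewrite -/(bform _ v v) bformDm bformZm bformDm -scaleN1r bformZm -sqnorm2E.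
have := Mp v v0; rewrite -/(bform _ v v) => b0; have s0 := sqnorm2_gt0 v0.
have [->|t0'] := eqVneq t 0; first by rewrite mul0r addr0.
have tp : 0 < t by rewrite lt_neqAle eq_sym t0'.
have h1 := mulr_gt0 tp s0.
have h2 : 0 <= (1 - t) * bform M v v by rewrite mulr_ge0 ?subr_ge0// ltW.
by lra.
Qed.

(* The coefficients come from the characteristic polynomial chi of M:
   det (1 + e M) = (- e) ^ n chi (- 1 / e). *)
Lemma det_add1_trace M :
  exists r : {poly R},
    forall e, \det (1%:M + e *: M) = 1 + e * \tr M + e ^+ 2 * r.[e].
Proof.
case: n M => [|m] M.
  by exists 0 => e; rewrite det_mx00 /mxtrace big_ord0 horner0 !mulr0 !addr0.
pose c := char_poly M.
(* The coefficient of index [i] in chi comes with [(- e) ^ (m + 1 - i)]. Indices [m + 1] and [m]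
   yield [1] and [e tr M]; each [i < m] leaves a factor [e ^ 2], and the truncated subtraction
   [m.-1 - i] is then exact. *)
exists (\sum_(i < m) c`_i *: (- 'X) ^+ (m.-1 - i)) => e.
have [->|e0] := eqVneq e 0.
  by rewrite scale0r addr0 det1 mul0r expr0n mul0r !addr0.
have -> : 1%:M + e *: M = (- e) *: ((- e^-1)%:M - M).
  by rewrite scalerBr scale_scalar_mx mulrNN divff// scaleNr opprK.
have -> : \det ((- e) *: ((- e^-1)%:M - M)) = (- e) ^+ m.+1 * c.[- e^-1].
  rewrite detZ; congr (_ * _); rewrite /c /char_poly -/(horner_eval _ _).
  rewrite -det_map_mx; congr (\det _); apply/matrixP => i j.
  by rewrite !mxE /= /horner_eval hornerD hornerN hornerMn hornerX hornerC.
have sc : size c = m.+2 by rewrite size_char_poly.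
have cm1 : c`_m.+1 = 1.
  by have /monicP := char_poly_monic M; rewrite lead_coefE sc.
have cm : c`_m = - \tr M by rewrite -char_poly_trace.
rewrite horner_coef sc !big_ord_recr/= cm1 cm.
have eV k : (k <= m.+1)%N -> (- e) ^+ m.+1 * (- e^-1) ^+ k = (- e) ^+ (m.+1 - k).
  move=> km; rewrite -invrN exprVn -{1}(subnK km) exprD mulfK//.
  by rewrite expf_neq0// oppr_eq0.
rewrite !mulrDr !mul1r eV// subnn expr0 mulrCA eV// subSnn expr1 mulNr mulrN opprK.
rewrite [RHS]addrC; rewrite (mulrC _ e) (addrC 1) -addrA.
congr (_ + _); rewrite horner_sum !mulr_sumr; apply: eq_bigr => i _.
rewrite mulrCA eV; last by rewrite ltnW// ltnW// !ltnS.
rewrite hornerZ horner_exp hornerN hornerX mulrCA; congr (_ * _).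
have im : (i <= m.-1)%N by move: (ltn_ord i); case: (m) i => [[]|].
have -> : (m.+1 - i = 2 + (m.-1 - i))%N.
  by rewrite addnBA// add2n prednK// (leq_ltn_trans _ (ltn_ord i)).
by rewrite exprD sqrrN.
Qed.

(** The points 1, ..., [size w] are distinct roots, too many for a nonzero polynomial. This allows
    an identity divided by [e ^ 2] to be read at [e = 0]. *)
Lemma horner_punctured_eq0 (w : {poly R}) :
  (forall e, e != 0 -> w.[e] = 0) -> w.[0] = 0.
Proof.
move=> w0; suff -> : w = 0 by rewrite horner0.
apply: (@roots_geq_poly_eq0 _ _ [seq i.+1%:R | i <- iota 0 (size w)]).
- by apply/allP => _ /mapP[i _ ->]; apply/rootP; rewrite w0// pnatr_eq0.
- by rewrite map_inj_uniq ?iota_uniq// => i j /eqP; rewrite eqr_nat => /eqP[].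
- by rewrite size_map size_iota.
Qed.

(* The value at 0 is obtained by comparing the coefficients of e ^ 2 in
   det (1 - e ^ 2 M ^ 2) = det (1 + e M) det (1 - e M). *)
Lemma det_add1_expand M :
  exists r : {poly R},
    (forall e, \det (1%:M + e *: M) = 1 + e * \tr M + e ^+ 2 * r.[e]) /\
    2 * r.[0] = (\tr M) ^+ 2 - \tr (M *m M).
Proof.
have [r rE] := det_add1_trace M; exists r; split=> //.
have [s sE] := det_add1_trace (M *m M).
(* [w] is the difference [det (1 + e M) det (1 - e M) - det (1 - e ^ 2 M ^ 2)], expanded and divided
   by [e ^ 2]; its value at 0 is [2 r(0) + tr M^2 - (tr M)^2]. *)
pose w : {poly R} := r + (r \Po - 'X) + (\tr (M *m M) - (\tr M) ^+ 2)%:P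
  + 'X * (\tr M)%:P * ((r \Po - 'X) - r)
  + 'X^2 * (r * (r \Po - 'X) - (s \Po - 'X^2)).
have : w.[0] = 0.
  apply: horner_punctured_eq0 => e e0.
  have := sE (- e ^+ 2).
  have -> : 1%:M + - e ^+ 2 *: (M *m M) = (1%:M + e *: M) *m (1%:M + (- e) *: M).
    rewrite mulmxDl mul1mx mulmxDr mulmx1 -scalemxAl -scalemxAr scalerA.
    by rewrite mulrN -expr2 !scaleNr addrA subrK.
  rewrite det_mulmx !rE => /eqP; rewrite -subr_eq0 => /eqP h.
  apply: (@mulfI _ (e ^+ 2)); first by rewrite expf_neq0.
  by rewrite mulr0 -[RHS]h /w !(hornerE, horner_comp, hornerXn)/=; ring.
rewrite /w !(hornerE, horner_comp, hornerXn)/= oppr0 => h0.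
by apply/eqP; rewrite -subr_eq0; apply/eqP; rewrite -[RHS]h0; ring.
Qed.

End determinant_expansion.

(** * Second-order limits of the trace of the inverse and of the log-determinant *)

Section second_differences.
Context {R : realType} {n : nat}.
Implicit Types G H K M : 'M[R]_n.

Lemma horner_cvg0 (p : {poly R}) : p.[e] @[e --> (0 : R)^'] --> p.[0].
Proof.
apply: cvg_trans (@continuous_horner R p 0).
by apply: cvg_app; exact: cvg_within.
Qed.

Lemma unitmx_near G K : G \in unitmx ->
  \forall e \near (0 : R)^', G + e *: K \in unitmx.
Proof.
move=> Gu; have [p pE] := det_pencil_poly G K.
have : \forall e \near (0 : R)^', p.[e] != 0.
  apply: (cvgr_neq0 _ (@horner_cvg0 p)).
  by rewrite -pE scale0r addr0 -unitfE -unitmxE.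
by apply: filterS => e; rewrite -pE -unitfE -unitmxE.
Qed.

(** By Cramer's rule the trace is a quotient of two polynomials in [e], with denominator nonzero at
    0. *)
Lemma trace_mul_invmx_cvg0 C G K : G \in unitmx ->
  \tr (C *m invmx (G + e *: K)) @[e --> (0 : R)^'] --> \tr (C *m invmx G).
Proof.
move=> Gu; have [p pE] := det_pencil_poly G K.
pose A : 'M[{poly R}]_n := map_mx polyC G + 'X *: map_mx polyC K.
pose q := \tr (map_mx polyC C *m \adj A).
have qE e : \tr (C *m \adj (G + e *: K)) = q.[e].
  rewrite /q -[RHS]/(horner_eval e _) -trace_map_mx map_mxM map_mx_adj.
  congr (\tr (_ *m \adj _)); apply/matrixP => i j.
    by rewrite !mxE /= /horner_eval hornerC.
  by rewrite !mxE /= /horner_eval !hornerE.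
have invE e : G + e *: K \in unitmx ->
    \tr (C *m invmx (G + e *: K)) = p.[e]^-1 * q.[e].
  by move=> eu; rewrite /invmx eu -scalemxAr mxtraceZ qE pE.
have -> : \tr (C *m invmx G) = p.[0]^-1 * q.[0].
  by rewrite -invE ?scale0r ?addr0.
have h : p.[e]^-1 * q.[e] @[e --> (0 : R)^'] --> p.[0]^-1 * q.[0].
  apply: cvgM; last exact: horner_cvg0.
  apply: cvgV; last exact: horner_cvg0.
  by rewrite -pE scale0r addr0 -unitfE -unitmxE.
apply: cvg_trans h; apply: near_eq_cvg; near=> e; rewrite -invE//.
by near: e; exact: unitmx_near.
Unshelve. all: by end_near. Qed.

(** The resolvent identity [B = X - e X K B] is substituted into itself once. The expansion is
    exact, the last term keeping the perturbed inverse, so no remainder has to be estimated. *)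
Lemma trace_invmx_expand G K e : G \in unitmx -> G + e *: K \in unitmx ->
  let X := invmx G in
  \tr (invmx (G + e *: K)) = \tr X - e * \tr (X *m K *m X)
    + e ^+ 2 * \tr (X *m K *m X *m K *m invmx (G + e *: K)).
Proof.
move=> Gu Au /=; set A := G + e *: K; set B := invmx A; set X := invmx G.
have XA : X *m A = 1%:M + e *: (X *m K).
  by rewrite mulmxDr mulVmx// -scalemxAr.
have BX : B = X - e *: (X *m K *m B).
  apply/eqP; rewrite eq_sym subr_eq -[X in X == _](mulmxK Au) XA mulmxDl.
  by rewrite mul1mx -scalemxAl.
have BE : B = X - e *: (X *m K *m X) + e ^+ 2 *: (X *m K *m X *m K *m B).
  rewrite {1}BX {1}BX mulmxBr -scalemxAr scalerBr scalerA -expr2 opprB.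
  by rewrite !mulmxA addrCA addrC.
by rewrite {1}BE mxtraceD raddfB /= !mxtraceZ.
Qed.

Definition second_difference (f : 'M[R]_n -> R) G H1 H2 (e : R) : R :=
  ((f (G + e *: H1 + e *: H2) - f (G + e *: H2)) - (f (G + e *: H1) - f G))
  / e ^+ 2.

Lemma dnbhs0_neq0 : \forall e \near (0 : R)^', e != 0.
Proof. exact: nbhs_dnbhs_neq. Qed.

(** As [a] is quadratic in [K], the limit is its polarization, a bilinear expression in [H1] and
    [H2]. *)
Lemma trace_invmx_second_difference_cvg G H1 H2 : G \in unitmx ->
  let X := invmx G in
  let a K := \tr (X *m K *m X *m K *m X) in
  second_difference (fun M => \tr (invmx M)) G H1 H2 e @[e --> (0 : R)^']
    --> a (H1 + H2) - a H2 - a H1.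
Proof.
move=> Gu X a.
pose b K e := \tr (X *m K *m X *m K *m invmx (G + e *: K)).
have bE K : b K e @[e --> (0 : R)^'] --> a K by exact: trace_mul_invmx_cvg0.
apply: cvg_trans; last exact: cvgB (cvgB (bE (H1 + H2)) (bE H2)) (bE H1).
apply: near_eq_cvg; near=> e.
have e0 : e != 0 by near: e; exact: dnbhs0_neq0.
have u1 : G + e *: H1 \in unitmx by near: e; exact: unitmx_near.
have u2 : G + e *: H2 \in unitmx by near: e; exact: unitmx_near.
have u12 : G + e *: (H1 + H2) \in unitmx by near: e; exact: unitmx_near.
rewrite /second_difference -(addrA G) -(scalerDr e) !trace_invmx_expand//.
rewrite -/X -/(b _ e) -/(b _ e) -/(b _ e).
have -> : \tr (X *m (H1 + H2) *m X) = \tr (X *m H1 *m X) + \tr (X *m H2 *m X).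
  by rewrite mulmxDr mulmxDl raddfD.
rewrite -[LHS]/(b (H1 + H2) e - b H2 e - b H1 e).
by field.
Unshelve. all: by end_near. Qed.

(** This is [ln (1 + y) <= y] applied to [1 + y = 1 / (1 + x)]. *)
Lemma ln1Dx_ge (x : R) : -1 < x -> x / (1 + x) <= ln (1 + x).
Proof.
move=> x1; have p : 0 < 1 + x by lra.
have e : (1 + x)^-1 = 1 + - (x / (1 + x)) by field; rewrite gt_eqF.
have q : 0 < (1 + x)^-1 by rewrite invr_gt0.
rewrite -[leRHS]opprK -lnV ?posrE// lerNr [in leLHS]e.
by apply: le_ln1Dx; lra.
Qed.

(* x / (1 + x) <= ln (1 + x) <= x with x = e ^ 2 z. *)
Lemma ln_sqr_quotient_cvg (z : R -> R) (l : R) :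
  z e @[e --> (0 : R)^'] --> l ->
  ln (1 + e ^+ 2 * z e) / e ^+ 2 @[e --> (0 : R)^'] --> l.
Proof.
move=> zl.
have sq : (1 + e ^+ 2 * z e) @[e --> (0 : R)^'] --> (1 : R).
  rewrite [X in _ --> X](_ : 1 = 1 + 0 * l); last by rewrite mul0r addr0.
  apply: cvgD; first exact: cvg_cst.
  apply: cvgM => //.
  have := @horner_cvg0 'X^2; rewrite hornerXn expr0n /=.
  by have -> : horner 'X^2 = (fun e : R => e ^+ 2) by apply/funext => e; exact: hornerXn.
have low : z e / (1 + e ^+ 2 * z e) @[e --> (0 : R)^'] --> l.
  rewrite [X in _ --> X](_ : l = l * 1^-1); last by rewrite invr1 mulr1.
  by apply: cvgM => //; apply: cvgV => //; exact: oner_neq0.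
apply: squeeze_cvgr low zl; near=> e.
have e0 : e != 0 by near: e; exact: dnbhs0_neq0.
have p : 0 < 1 + e ^+ 2 * z e.
  by near: e; exact: (cvgr_gt _ sq _ ltr01).
have e2 : 0 < e ^+ 2 by rewrite exprn_even_gt0.
have x1 : -1 < e ^+ 2 * z e by lra.
apply/andP; split.
  by rewrite ler_pdivlMr// mulrC mulrA ln1Dx_ge.
by rewrite ler_pdivrMr// (mulrC (z e)) le_ln1Dx.
Unshelve. all: by end_near. Qed.

(** Off the diagonal only the existence of the limit matters; its value is recorded where the sign
    is to be determined. *)
Lemma logdet_second_difference_cvg G H1 H2 : posdefmx G ->
  exists l, second_difference (fun M => ln (\det M)) G H1 H2 e
      @[e --> (0 : R)^'] --> l /\
    (H1 = H2 -> l = - \tr (invmx G *m H1 *m invmx G *m H1)).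
Proof.
move=> Gpd; have Gu := posdefmx_unit Gpd; have dG := posdefmx_det_gt0 Gpd.
set X := invmx G.
have [r1 [D1 r10]] := det_add1_expand (X *m H1).
have [r2 [D2 r20]] := det_add1_expand (X *m H2).
have [r12 [D12 r120]] := det_add1_expand (X *m (H1 + H2)).
set t1 := \tr (X *m H1) in D1 r10; set t2 := \tr (X *m H2) in D2 r20.
have t12 : \tr (X *m (H1 + H2)) = t1 + t2 by rewrite mulmxDr raddfD.
rewrite {}t12 in D12 r120.
pose d1 := 1 + t1 *: 'X + 'X^2 * r1; pose d2 := 1 + t2 *: 'X + 'X^2 * r2.
pose d12 := 1 + (t1 + t2) *: 'X + 'X^2 * r12.
(* [y] is chosen so that [d12 - d1 d2 = e ^ 2 y]: the terms of order 0 and 1 cancel. *)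
pose y := r12 - r1 - r2 - (t1 * t2)%:P - 'X * (t1 *: r2 + t2 *: r1) - 'X^2 * (r1 * r2).
have dE K e : \det (G + e *: K) = \det G * \det (1%:M + e *: (X *m K)).
  by rewrite -det_mulmx mulmxDr mulmx1 -scalemxAr mulmxA mulmxV// mul1mx.
have d1E e : \det (G + e *: H1) = \det G * d1.[e].
  by rewrite dE D1 /d1 !(hornerE, hornerXn)/= (mulrC t1).
have d2E e : \det (G + e *: H2) = \det G * d2.[e].
  by rewrite dE D2 /d2 !(hornerE, hornerXn)/= (mulrC t2).
have d12E e : \det (G + e *: (H1 + H2)) = \det G * d12.[e].
  by rewrite dE D12 /d12 !(hornerE, hornerXn)/= (mulrC (t1 + t2)).
have pos (p : {poly R}) : p.[0] = 1 -> \forall e \near (0 : R)^', 0 < p.[e].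
  by move=> p0; apply: (cvgr_gt _ (@horner_cvg0 p)); rewrite p0.
have v1 : d1.[0] = 1.
  by rewrite /d1 !(hornerE, hornerXn)/= expr0n !(mulr0, mul0r) !addr0.
have v2 : d2.[0] = 1.
  by rewrite /d2 !(hornerE, hornerXn)/= expr0n !(mulr0, mul0r) !addr0.
have v12 : d12.[0] = 1.
  by rewrite /d12 !(hornerE, hornerXn)/= expr0n !(mulr0, mul0r) !addr0.
exists y.[0]; split; last first.
  (* With [t = tr (X H)] and [T = tr (X H X H)], one has [2 r1(0) = 2 r2(0) = t^2 - T] and
     [2 r12(0) = 4 t^2 - 4 T], so [y(0) = r12(0) - 2 r1(0) - t^2 = - T]. *)
  move=> H12; have t21 : t2 = t1 by rewrite /t2 -H12.
  move: r10 r20 r120; rewrite t21 -H12.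
  have -> : \tr (X *m (H1 + H1) *m (X *m (H1 + H1))) = 4 * \tr (X *m H1 *m (X *m H1)).
    by rewrite mulmxDr mulmxDl mulmxDr !raddfD /=; ring.
  rewrite (mulmxA (X *m H1) X H1) => h1 h2 h12.
  rewrite /y t21 !(hornerE, hornerXn)/=; nra.
(* The factors [det G] cancel in the second difference, leaving the logarithm of
   [d12 / (d1 d2) = 1 + e ^ 2 z]. *)
pose z e := y.[e] / (d1.[e] * d2.[e]).
have zl : z e @[e --> (0 : R)^'] --> y.[0].
  rewrite [X in _ --> X](_ : _ = y.[0] * (d1.[0] * d2.[0])^-1); last first.
    by rewrite v1 v2 mulr1 invr1 mulr1.
  apply: cvgM; first exact: horner_cvg0.
  apply: cvgV; first by rewrite v1 v2 mulr1 oner_neq0.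
  by apply: cvgM; exact: horner_cvg0.
apply: cvg_trans (ln_sqr_quotient_cvg zl); apply: near_eq_cvg; near=> e.
have e0 : e != 0 by near: e; exact: dnbhs0_neq0.
have p1 : 0 < d1.[e] by near: e; exact: pos.
have p2 : 0 < d2.[e] by near: e; exact: pos.
have p12 : 0 < d12.[e] by near: e; exact: pos.
rewrite /second_difference -(addrA G) -(scalerDr e) d1E d2E d12E; congr (_ / _).
have -> : 1 + e ^+ 2 * z e = d12.[e] / (d1.[e] * d2.[e]).
  have nz : d1.[e] * d2.[e] != 0 by rewrite mulf_neq0 ?gt_eqF.
  apply: (mulIf nz); rewrite /z mulrDl mul1r -(mulrA (e ^+ 2)) !divfK//.
  by rewrite /y /d1 /d2 /d12 !(hornerE, hornerXn)/=; ring.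
rewrite lnM ?posrE ?invr_gt0 ?mulr_gt0// lnV ?posrE ?mulr_gt0//.
rewrite !lnM ?posrE//; ring.
Unshelve. all: by end_near. Qed.

End second_differences.

Lemma Rintegral_sum {disp : measure_display} {T : measurableType disp}
    {R : realType} (m : {measure set T -> \bar R}) (D : set T) (I : Type)
    (s : seq I) (f : I -> T -> R) :
  measurable D -> (forall i, m.-integrable D (EFin \o f i)) ->
  Rintegral m D (fun x => \sum_(i <- s) f i x) = \sum_(i <- s) Rintegral m D (f i).
Proof.
move=> mD fi; elim: s => [|i s IH].
  rewrite big_nil /Rintegral; under eq_integral do rewrite big_nil.
  by rewrite integral0.
rewrite big_cons -IH -RintegralD//; last first.
  rewrite (_ : EFin \o _ = fun x => (\sum_(i <- s) (f i x)%:E)%E).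
    by apply: integrable_sum => // j _; exact: fi.
  by apply/funext => x /=; rewrite sumEFin.
by apply: eq_Rintegral => x _; rewrite big_cons.
Qed.

(** * The Gram matrix as a linear function of the signed measure *)

Section design_functionals.
Context {R : realType} {p d : nat}.
Variables (Omega : set (borel_rV R p)) (mOmega : measurable Omega).
Variables (A : borel_rV R p -> borel_rV R d) (mA : measurable_fun Omega A).
Implicit Types mu nu eta : {charge set (borel_rV R p) -> \bar R}.

Let norm2 (theta : borel_rV R p) : R := sqnorm2 (A theta).

(** Open intervals generate the Borel sets of the line, and their preimages under the continuous
    coordinate map are open. *)
Lemma measurable_coord (i : 'I_d) :
  measurable_fun Omega (fun theta => (A theta : 'rV[R]_d) 0 i).
Proof.
have mc : measurable_fun [set: borel_rV R d] (fun v : borel_rV R d => (v : 'rV[R]_d) 0 i).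
  apply: (measurability _ (RGenOpens.measurableE R)).
  move=> _ [_ [a [b ->] <-]]; rewrite setTI; apply: sub_sigma_algebra.
  have /continuousP := @coord_continuous R 1 d 0 i.
  by apply; exact: interval_open.
exact: (measurableT_comp mc mA).
Qed.

Lemma measurable_norm2 : measurable_fun Omega norm2.
Proof.
apply: measurable_sum => i; exact: measurable_funX (measurable_coord i).
Qed.

Lemma gram_entryE theta i j :
  ((A theta)^T *m A theta) i j = (A theta : 'rV[R]_d) 0 i * (A theta : 'rV[R]_d) 0 j.
Proof. by rewrite mxE big_ord1 mxE. Qed.

(** Each product of two coordinates of [A theta] is dominated by [norm2 theta]. *)
Lemma integrable_gram_entry (m : {measure set (borel_rV R p) -> \bar R}) i j :
  m.-integrable Omega (EFin \o norm2) ->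
  m.-integrable Omega (EFin \o (fun theta => ((A theta)^T *m A theta) i j)).
Proof.
apply: le_integrable => //.
  apply/measurable_EFinP; under eq_fun do rewrite gram_entryE.
  by apply: measurable_funM; exact: measurable_coord.
move=> theta _ /=; rewrite lee_fin gram_entryE [leRHS]ger0_norm ?sqnorm2_ge0//.
rewrite ler_norml /norm2.
move: (sqr_coord_le (A theta) i) (sqr_coord_le (A theta) j).
move: (sqnorm2 _) (fun_of_matrix _ _ i) (fun_of_matrix _ _ j) => S a b ha hb.
by have := sqr_ge0 (a + b); have := sqr_ge0 (a - b); move=> *; apply/andP; split; nra.
Qed.

Lemma integrable_norm2P (m : {measure set (borel_rV R p) -> \bar R}) :
  (\int[m]_(theta in Omega) (norm2 theta)%:E < +oo)%E <->
  m.-integrable Omega (EFin \o norm2).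
Proof.
have mn : measurable_fun Omega (EFin \o norm2).
  by apply/measurable_EFinP; exact: measurable_norm2.
have e : (\int[m]_(theta in Omega) `|(EFin \o norm2) theta| =
          \int[m]_(theta in Omega) (norm2 theta)%:E)%E.
  by apply: eq_integral => theta _; rewrite gee0_abs// lee_fin sqnorm2_ge0.
by split=> [h|/integrableP[_]]; [apply/integrableP; rewrite e|rewrite e].
Qed.

Lemma cintegrable_gram_entry mu i j : cintegrable Omega mu norm2 ->
  cintegrable Omega mu (fun theta => ((A theta)^T *m A theta) i j).
Proof. by move=> [? ?]; split; exact: integrable_gram_entry. Qed.

Lemma gram_cadd mu nu :
  cintegrable Omega mu norm2 -> cintegrable Omega nu norm2 ->
  gram Omega A (cadd mu nu) = gram Omega A mu + gram Omega A nu.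
Proof.
move=> imu inu; apply/matrixP => i j; rewrite !mxE.
by apply: (charge_Rintegral_cadd mOmega _ _).2; exact: cintegrable_gram_entry.
Qed.

Lemma gram_cscale k mu : cintegrable Omega mu norm2 ->
  gram Omega A (cscale k mu) = k *: gram Omega A mu.
Proof.
move=> imu; apply/matrixP => i j; rewrite !mxE.
by apply: (charge_Rintegral_cscale mOmega _ _).2; exact: cintegrable_gram_entry.
Qed.

Lemma trmx_gram mu : (gram Omega A mu)^T = gram Omega A mu.
Proof.
apply/matrixP => i j; rewrite !mxE; congr (charge_Rintegral _ _ _).
by apply/funext => theta; rewrite !gram_entryE mulrC.
Qed.

(** Trace and integral are exchanged entry by entry. Besides the two Hessian signs, this yields the
    semidefiniteness of the Gram matrix itself, by taking [P = v^T v]. *)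
Lemma trace_gram_mul_ge0 (m : {finite_measure set (borel_rV R p) -> \bar R})
    (P : 'M[R]_d) :
  m.-integrable Omega (EFin \o norm2) -> (forall v, 0 <= bform P v v) ->
  0 <= \tr (gram Omega A (charge_of_finite_measure m) *m P).
Proof.
move=> im P0.
pose f (k : 'I_d * 'I_d) theta := P k.2 k.1 * ((A theta)^T *m A theta) k.1 k.2.
have fi k : m.-integrable Omega (EFin \o f k).
  have := integrableZl mOmega (P k.2 k.1) (integrable_gram_entry k.1 k.2 im).
  by apply: eq_integrable.
suff -> : \tr (gram Omega A (charge_of_finite_measure m) *m P) =
    Rintegral m Omega (fun theta => bform P (A theta) (A theta)).
  by apply: Rintegral_ge0 => theta _; exact: P0.
transitivity (\sum_(k : 'I_d * 'I_d) Rintegral m Omega (f k)).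
  rewrite -(pair_bigA _ (fun i j => Rintegral m Omega (f (i, j)))) /=.
  apply: eq_bigr => i _; rewrite mxE; apply: eq_bigr => j _.
  rewrite mxE (charge_Rintegral_measure mOmega (integrable_gram_entry i j im)).2.
  by rewrite mulrC -RintegralZl//; exact: integrable_gram_entry.
rewrite -Rintegral_sum//; apply: eq_Rintegral => theta _.
rewrite bformE exchange_big /= pair_bigA /=; apply: eq_bigr => -[i j] _ /=.
by rewrite /f gram_entryE /=; ring.
Qed.

Lemma total_variation_norm2P mu :
  (\int[Defs.total_variation mu]_(theta in Omega) (sqnorm2 (A theta))%:E
     < +oo)%E <-> cintegrable Omega mu norm2.
Proof.
exact: iff_trans (integrable_norm2P _) (iff_sym (cintegrableP mOmega _ _)).
Qed.

Lemma concentrated_on_cadd mu nu : concentrated_on Omega mu ->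
  concentrated_on Omega nu -> concentrated_on Omega (cadd mu nu).
Proof.
by move=> mu0 nu0 B mB BO; rewrite /cadd /= mu0// nu0// adde0.
Qed.

Lemma concentrated_on_cscale k mu : concentrated_on Omega mu ->
  concentrated_on Omega (cscale k mu).
Proof. by move=> mu0 B mB BO; rewrite /cscale /= mu0// mule0. Qed.

Lemma design_domP mu : design_dom Omega A mu <->
  [/\ concentrated_on Omega mu, cintegrable Omega mu norm2 &
      posdefmx (gram Omega A mu)].
Proof. by split=> -[c /total_variation_norm2P i pd]; split. Qed.

Lemma posdefmx_gram (m : {finite_measure set (borel_rV R p) -> \bar R}) :
  m.-integrable Omega (EFin \o norm2) ->
  gram Omega A (charge_of_finite_measure m) \in unitmx ->
  posdefmx (gram Omega A (charge_of_finite_measure m)).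
Proof.
move=> im; apply: semiposmx_unit_posdef; split; first exact: trmx_gram.
move=> v; have -> : bform (gram Omega A (charge_of_finite_measure m)) v v =
    \tr (gram Omega A (charge_of_finite_measure m) *m (v^T *m v)).
  by rewrite /bform -trace_mx11 -mulmxA mxtrace_mulC mulmxA.
apply: trace_gram_mul_ge0 => // w.
rewrite /bform mulmxA -mulmxA -[v in v *m w^T]trmxK -trmx_mul.
by rewrite mxE big_ord1 [X in _ * X]mxE -expr2 sqr_ge0.
Qed.

(** * Hessian quotients along admissible directions *)

Section perturbations.
Variables (rho eta1 eta2 : {charge set (borel_rV R p) -> \bar R}).
Hypotheses (rho_dom : design_dom Omega A rho).
Hypotheses (adm1 : admissible Omega A eta1) (adm2 : admissible Omega A eta2).

Local Notation G := (gram Omega A rho).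
Local Notation H1 := (gram Omega A eta1).
Local Notation H2 := (gram Omega A eta2).

(** Linearity of [gram] needs integrability only, so the equality holds for every [e], inside the
    domain or not, and can be rewritten under the limit. *)
Lemma hessian_quotient_gram (F : 'M[R]_d -> R) e :
  hessian_quotient (F \o gram Omega A) rho eta1 eta2 e =
  second_difference F G H1 H2 e.
Proof.
have /design_domP[_ i0 _] := rho_dom.
have [_ _ _ /total_variation_norm2P i1] := adm1.
have [_ _ _ /total_variation_norm2P i2] := adm2.
have s1 := (charge_Rintegral_cscale mOmega e i1).1.
have s2 := (charge_Rintegral_cscale mOmega e i2).1.
have a1 := (charge_Rintegral_cadd mOmega i0 s1).1.
by rewrite /hessian_quotient /second_difference /= !gram_cadd// !gram_cscale.
Qed.

(** Concentration and integrability hold for every [e]. Only definiteness restricts [e], through the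
    pencils in the directions [H1], [H2] and [H1 + H2]. *)
Lemma design_dom_near :
  \forall e \near (0 : R)^',
    [/\ design_dom Omega A (cadd (cadd rho (cscale e eta1)) (cscale e eta2)),
        design_dom Omega A (cadd rho (cscale e eta1)) &
        design_dom Omega A (cadd rho (cscale e eta2))].
Proof.
have /design_domP[c0 i0 G0] := rho_dom.
have [c1 _ _ /total_variation_norm2P i1] := adm1.
have [c2 _ _ /total_variation_norm2P i2] := adm2.
have near_pd H : H^T = H -> \forall e \near (0 : R)^', posdefmx (G + e *: H).
  by move=> Hs; exact: cvg_within (posdefmx_near G0 Hs).
have n1 := near_pd H1 (trmx_gram eta1).
have n2 := near_pd H2 (trmx_gram eta2).
have n12 : \forall e \near (0 : R)^', posdefmx (G + e *: (H1 + H2)).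
  by apply: near_pd; rewrite linearD /= !trmx_gram.
apply: filterS3 n1 n2 n12 => e p1 p2 p12.
have s1 := (charge_Rintegral_cscale mOmega e i1).1.
have s2 := (charge_Rintegral_cscale mOmega e i2).1.
have a1 := (charge_Rintegral_cadd mOmega i0 s1).1.
have a2 := (charge_Rintegral_cadd mOmega i0 s2).1.
have a12 := (charge_Rintegral_cadd mOmega a1 s2).1.
have cs1 := concentrated_on_cscale e c1; have cs2 := concentrated_on_cscale e c2.
have ca1 := concentrated_on_cadd c0 cs1; have ca2 := concentrated_on_cadd c0 cs2.
have ca12 := concentrated_on_cadd ca1 cs2.
have g1 : gram Omega A (cadd rho (cscale e eta1)) = G + e *: H1.
  by rewrite (gram_cadd i0 s1) (gram_cscale e i1).
have g2 : gram Omega A (cadd rho (cscale e eta2)) = G + e *: H2.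
  by rewrite (gram_cadd i0 s2) (gram_cscale e i2).
have g12 : gram Omega A (cadd (cadd rho (cscale e eta1)) (cscale e eta2)) =
    G + e *: (H1 + H2).
  by rewrite (gram_cadd a1 s2) g1 (gram_cscale e i2) scalerDr addrA.
rewrite -g1 in p1; rewrite -g2 in p2; rewrite -g12 in p12.
by split; apply/design_domP; [exact: And3 ca12 a12 p12|exact: And3 ca1 a1 p1
  |exact: And3 ca2 a2 p2].
Qed.

Lemma FA_hessian_cvg :
  let X := invmx G in let a K := \tr (X *m K *m X *m K *m X) in
  hessian_quotient (FA Omega A) rho eta1 eta2 e @[e --> (0 : R)^']
    --> a (H1 + H2) - a H2 - a H1.
Proof.
have /design_domP[_ _ /posdefmx_unit Gu] := rho_dom.
move=> X a; have := @trace_invmx_second_difference_cvg _ _ G H1 H2 Gu.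
by under eq_fun do rewrite -hessian_quotient_gram.
Qed.

Lemma FD_hessian_cvg :
  exists l, hessian_quotient (FD Omega A) rho eta1 eta2 e
      @[e --> (0 : R)^'] --> l /\
    (H1 = H2 -> l = - \tr (invmx G *m H1 *m invmx G *m H1)).
Proof.
have /design_domP[_ _ Gpd] := rho_dom.
have [l [cl lE]] := @logdet_second_difference_cvg _ _ G H1 H2 Gpd.
exists l; split=> //; move: cl.
by under eq_fun do rewrite -hessian_quotient_gram.
Qed.

End perturbations.
End design_functionals.

Theorem proposition4p3 (R : realType) (p d : nat)
    (Omega : set (borel_rV R p)) (mOmega : measurable Omega)
    (A : borel_rV R p -> borel_rV R d) (mA : measurable_fun Omega A)
    (rho : probability (borel_rV R p) R)
    (rho_Omega : concentrated_on Omega rho)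
    (rho_moment2 :
      (\int[rho]_(theta in Omega) (sqnorm2 theta)%:E < +oo)%E)
    (rho_A :
      (\int[rho]_(theta in Omega) (sqnorm2 (A theta))%:E < +oo)%E)
    (gram_unit : gram Omega A (charge_of_finite_measure rho) \in unitmx) :
  (forall eta1 eta2 : {charge set (borel_rV R p) -> \bar R},
     admissible Omega A eta1 -> admissible Omega A eta2 ->
     hessian_exists (design_dom Omega A) (FA Omega A)
       (charge_of_finite_measure rho) eta1 eta2 /\
     hessian_exists (design_dom Omega A) (FD Omega A)
       (charge_of_finite_measure rho) eta1 eta2) /\
  (forall eta : {charge set (borel_rV R p) -> \bar R},
     admissible Omega A eta ->
     0 <= hessian (FA Omega A) (charge_of_finite_measure rho) eta eta /\
     hessian (FD Omega A) (charge_of_finite_measure rho) eta eta <= 0).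
Proof.
have im := (integrable_norm2P mA rho).1 rho_A.
set r := charge_of_finite_measure rho; set G := gram Omega A r.
have Gpd : posdefmx G by exact: posdefmx_gram.
have rdom : design_dom Omega A r.
  apply/design_domP => //; split=> //.
  exact: (charge_Rintegral_measure mOmega im).1.
have [Gs _] := Gpd.
set X := invmx G; have Xs : X^T = X by rewrite trmx_inv Gs.
have XG : X *m G = 1%:M by rewrite mulVmx.
split=> [eta1 eta2 adm1 adm2|eta adm].
  have near_dom := design_dom_near mOmega mA rdom adm1 adm2.
  split; split=> //.
    by apply/cvg_ex; eexists; exact: FA_hessian_cvg.
  have [l [cl _]] := FD_hessian_cvg mOmega mA rdom adm1 adm2.
  by apply/cvg_ex; exists l.
set H := gram Omega A eta; have Hs : H^T = H by exact: trmx_gram.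
split.
  have /(cvg_lim (@Rhausdorff R)) := FA_hessian_cvg mOmega mA rdom adm adm.
  rewrite /hessian => ->; rewrite -/H -/G -/X.
  set a := \tr (X *m H *m X *m H *m X).
  (* On the diagonal the limit is [4 a - a - a = 2 a]. *)
  have -> : \tr (X *m (H + H) *m X *m (H + H) *m X) = 4 * a.
    by rewrite !(mulmxDr, mulmxDl, raddfD) /= -/a; ring.
  suff : 0 <= a by lra.
  pose Y := X *m H *m X.
  (* [Y] is symmetric and [G X = 1], so the right side is [tr (H X X H X)], a cyclic rearrangement
     of [a]. *)
  have -> : a = \tr (G *m (Y *m Y^T)).
    rewrite /Y !trmx_mul Xs Hs /a !mulmxA mulmxV ?mul1mx//.
    by rewrite -3!mulmxA mxtrace_mulC -[in RHS]mulmxA [in RHS]mxtrace_mulC !mulmxA.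
  apply: trace_gram_mul_ge0 => // v.
  have -> : bform (Y *m Y^T) v v = sqnorm2 (v *m Y).
    by rewrite sqnorm2E /bform mulmx1 (trmx_mul v Y) !mulmxA.
  exact: sqnorm2_ge0.
have [l [cl lE]] := FD_hessian_cvg mOmega mA rdom adm adm.
have /(cvg_lim (@Rhausdorff R)) := cl.
rewrite /hessian => ->; rewrite lE// oppr_le0 -/H -/G -/X.
(* As [X G X = X], this is [(X H X) G (X H X)], so its form at [v] is that of [G] at [v X H X]. *)
pose P := X *m H *m X *m H *m X.
have -> : \tr (X *m H *m X *m H) = \tr (G *m P).
  by rewrite [RHS]mxtrace_mulC /P -(mulmxA _ X G) XG mulmx1.
apply: trace_gram_mul_ge0 => // v.
have -> : bform P v v = bform G (v *m X *m H *m X) (v *m X *m H *m X).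
  rewrite /bform !trmx_mul Xs Hs !mulmxA.
  by rewrite -(mulmxA _ X G) XG mulmx1.
by have [_] := posdefmx_semipos Gpd; exact.
Qed.
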